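(* For any even number $k>2$ and any integer $n>2k$, $$\alpha(P(n,k)) \leq \left\lfloor \frac{(2k-1)n}{2k}\right\rfloor .$$
   Context: For positive integers $n,k$ with $n>2k$, the generalized Petersen graph $P(n,k)$ is the graph with vertex set $\{u_i,v_i : i=1,\dots,n\}$ (so $2n$ vertices) and edge set $\{u_iu_{i+1},\ u_iv_i,\ v_iv_{i+k} : i=1,\dots,n\}$, subscripts being reduced modulo $n$. For a graph $G$, $\alpha(G)$ denotes the independence number, i.e. the size of a largest set of pairwise non-adjacent vertices. *)

(* Defs.v *)
From mathcomp Require Import all_boot.

Set Implicit Arguments.
Unset Strict Implicit.
Unset Printing Implicit Defensive.

Section IndependenceNumber.

Variables (T : finType) (e : rel T).

Definition independent (S : {set T}) : bool :=
  [forall x in S, forall y in S, ~~ e x y].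

Definition independence_number : nat :=
  \max_(S : {set T} | independent S) #|S|.

End IndependenceNumber.

(* [inl i] is the vertex u_i and [inr i] is the vertex v_i; the indices
   1, ..., n modulo n are represented by 0, ..., n - 1. *)
Definition gp_vertex (n : nat) : finType := ('I_n + 'I_n)%type.

(* The edge set {u_i u_(i+1), u_i v_i, v_i v_(i+k)} with a chosen orientation. *)
Definition gp_arc (n k : nat) : rel (gp_vertex n) := fun x y =>
  match x, y with
  | inl i, inl j => j == i + 1 %[mod n]
  | inl i, inr j => i == j
  | inr i, inr j => j == i + k %[mod n]
  | inr _, inl _ => false
  end.

Definition gen_petersen (n k : nat) : rel (gp_vertex n) :=
  fun x y => gp_arc k x y || gp_arc k y x.

Lemma gen_petersen_sym (n k : nat) : symmetric (@gen_petersen n k).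
Proof. by move=> x y; rewrite /gen_petersen orbC. Qed.

Lemma gen_petersen_irrefl (n k : nat) :
  0 < k -> 2 * k < n -> irreflexive (@gen_petersen n k).
Proof.
move=> k_gt0 ltkn x; rewrite /gen_petersen orbb.
have ltn d : 0 < d -> d < n -> forall i : nat, (i == i + d %[mod n]) = false.
  move=> d_gt0 ltdn i; rewrite -{1}[i]addn0 eqn_modDl mod0n modn_small //.
  by rewrite eq_sym -leqn0 leqNgt d_gt0.
have le_kn : k < n by apply: leq_ltn_trans ltkn; rewrite leq_pmull.
by case: x => i /=; apply: ltn => //; apply: leq_ltn_trans le_kn.
Qed.

(* Main.v *)
Require Import Defs.
From mathcomp Require Import all_boot.
From mathcomp Require Import zify.

(** Call an index i vacant if neither u_i nor v_i is in the independent set S.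
    As S contains at most one of u_i and v_i, it suffices to show that at least
    n / 2k of the n indices are vacant, i.e. that the cyclic gaps between
    consecutive vacant indices are at most 2k on average.  Among 2k consecutive
    non-vacant indices, membership of the u_i is forced to be
    1010...10 0101...01; hence no gap exceeds 2k + 1.  A gap of 2k + 1 ending at
    z forces v_(z+2), v_(z+4), ..., v_(z+k-2) out of S (call z blocked), no gap
    of 2k + 1 starts at a blocked index, and a gap of 2k starting at a blocked
    index ends at a blocked one.  So every gap from z to z' is at most
    2k + [z' blocked] - [z blocked], and the corrections telescope around the
    cycle. *)

Section Lift.

(** [u] and [v] model membership of u_i and v_i in S with indices unrolled from residues modulo n to
    all naturals, so that runs never wrap around. *)
Variables (k : nat) (u v : pred nat).
Hypotheses (k_even : ~~ odd k) (k_gt2 : 2 < k).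
Hypothesis uu : forall i, u i -> ~~ u i.+1.
Hypothesis uv : forall i, u i -> ~~ v i.
Hypothesis vv : forall i, v i -> ~~ v (i + k).

Definition vacant i := ~~ u i && ~~ v i.

Definition blocked z :=
  [forall j : 'I_k, (0 < j) && ~~ odd j ==> ~~ v (z + j)].

Lemma blockedP z :
  reflect (forall j, 0 < j -> j < k -> ~~ odd j -> ~~ v (z + j)) (blocked z).
Proof.
apply: (iffP forallP) => [H j j0 jk oj|H j].
  by have := H (Ordinal jk); rewrite /= j0 oj.
by apply/implyP => /andP[j0 oj]; apply: H.
Qed.

Lemma occupied_v i : ~~ vacant i -> v i = ~~ u i.
Proof. by rewrite /vacant; have := @uv i; case: (u i); case: (v i) => // /(_ isT). Qed.

Lemma occupied_u i : ~~ vacant i -> ~~ vacant (i + k) -> ~~ u i -> u (i + k).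
Proof.
move=> /occupied_v vi /occupied_v vik ui.
by have := @vv i; rewrite vi vik ui negbK; apply.
Qed.

Lemma run_pattern a : (forall i, i < 2 * k -> ~~ vacant (a + i)) ->
  forall j, j < k -> (u (a + j) = ~~ odd j) /\ (u (a + k + j) = odd j).
Proof.
move=> occ.
have cover j : j < k -> ~~ u (a + j) -> u (a + k + j).
  move=> jk; rewrite addnAC; apply: occupied_u; first by apply: occ; lia.
  by rewrite -addnA; apply: occ; lia.
have uS j : u (a + j) -> ~~ u (a + j.+1) by rewrite addnS; apply: uu.
have ukS j : u (a + k + j) -> ~~ u (a + k + j.+1) by rewrite addnS; apply: uu.
(* Two consecutive absences in the first half would force, via [cover], two adjacent members in the
   second. *)
have alt j : j.+1 < k -> u (a + j.+1) = ~~ u (a + j).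
  move=> jk; have := cover j (ltnW jk); have := cover _ jk.
  have := uS j; have := ukS j.
  lia.
have altE j : j < k -> u (a + j) = u a (+) odd j.
  elim: j => [|j IHj] jk; first by rewrite addn0 addbF.
  by rewrite alt // IHj ?(ltnW jk) //= addbN.
(* Otherwise, as k - 1 is odd, alternation puts u_(a+k-1) in S, while the absence of u_a forces its
   neighbour u_(a+k). *)
have ua : u a.
  apply/negPn/negP => nua.
  have uk : u (a + k) by rewrite -[a + k]addn0; apply: cover; rewrite ?addn0 //; lia.
  have : u (a + k.-1) by rewrite altE ?(negbTE nua) //=; lia.
  by move/uS; rewrite prednK ?uk //; lia.
move=> j jk; split; first by rewrite altE ?ua.
have [oj|oj] := boolP (odd j); first by rewrite cover ?altE ?ua ?oj.
apply/negbTE/negP => /ukS; case: (ltnP j.+1 k) => [j1k|kj]; last by lia.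
by rewrite cover // altE // ua /= oj.
Qed.

(** A run of 2k + 1 non-vacant indices contains two runs of length 2k, and their patterns put both
    u_a and u_(a+1) in S. *)
Lemma vacant_near a : exists2 i, i <= 2 * k & vacant (a + i).
Proof.
have [/existsP[i vi]|/existsPn novac] :=
  boolP [exists i : 'I_(2 * k).+1, vacant (a + i)].
  by exists i => //; apply: (ltn_ord i).
have occ i : i <= 2 * k -> ~~ vacant (a + i).
  by rewrite -ltnS => ik; apply: (novac (Ordinal ik)).
have k0 : 0 < k by lia.
have [ua _] : u (a + 0) = true /\ u (a + k + 0) = false.
  by apply: run_pattern k0 => i ik; apply/occ/ltnW.
have [uSa _] : u (a.+1 + 0) = true /\ u (a.+1 + k + 0) = false.
  by apply: run_pattern k0 => i ik; rewrite addSnnS occ.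
by have := @uu _ ua; rewrite -addSn uSa.
Qed.

Lemma gap_bound z g : 0 < g -> vacant (z + g) ->
  (forall i, 0 < i -> i < g -> ~~ vacant (z + i)) ->
  g + blocked z <= 2 * k + blocked (z + g).
Proof.
move=> g0 vzg occ.
have g_le : g <= (2 * k).+1.
  have [i ik vi] := vacant_near z.+1; rewrite leqNgt; apply/negP => gk.
  by move: vi; rewrite addSnnS; apply/negP/occ => //; lia.
have [gE|g_neq] := eqVneq g (2 * k).+1.
  have pat : forall j, j < k ->
      u (z.+1 + j) = ~~ odd j /\ u (z.+1 + k + j) = odd j.
    by apply: run_pattern => i ik; rewrite addSnnS occ ?gE.
  have -> : blocked z = false.
    apply/negP => /blockedP/(_ 2 isT k_gt2 isT).
    rewrite occupied_v; last by apply: occ; lia.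
    have [] := pat 1 (ltnW k_gt2); rewrite addSnnS => -> _ //.
  (* At even j the second half of the pattern lacks u, so v_(z+1+k+j) is in S and excludes
     v_(z+g+j). *)
  have -> : blocked (z + g).
    apply/blockedP => j j0 jk oj.
    have -> : z + g + j = (z.+1 + k + j) + k by lia.
    apply: vv; rewrite occupied_v; first by have [_ ->] := pat j jk.
    have -> : z.+1 + k + j = z + (k + j).+1 by lia.
    by apply: occ; lia.
  lia.
have [bz|nbz] := boolP (blocked z); last by lia.
have [gE|g_neq2] := eqVneq g (2 * k); last by lia.
suff -> : blocked (z + g) by lia.
(* Blockedness forces u at even offsets, hence not at odd ones. For even j, the absent u_(z+j-1)
   then forces u_(z+k+j-1), which yields v_(z+k+j) and excludes v_(z+2k+j). *)
have u_even j : 0 < j -> j < k -> ~~ odd j -> u (z + j).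
  move=> j0 jk oj; have := blockedP _ bz j j0 jk oj.
  by rewrite occupied_v ?negbK //; apply: occ; lia.
have u_odd j : j < k -> odd j -> ~~ u (z + j).
  move=> jk oj; have [j1|j_gt1] := leqP j 1.
    have -> : j = 1 by lia.
    by apply/negP => /uu; rewrite -addnS u_even.
  have -> : z + j = (z + j.-1).+1 by lia.
  by apply: uu; apply: u_even; lia.
apply/blockedP => j j0 jk oj.
have -> : z + g + j = (z + (k + j)) + k by lia.
apply: vv; rewrite occupied_v; last by apply: occ; lia.
have -> : z + (k + j) = (z + j.-1 + k).+1 by lia.
apply/uu/occupied_u; [apply: occ; lia | | by apply: u_odd; lia].
by rewrite -addnA; apply: occ; lia.
Qed.

(** Strong induction on d, splitting off the first gap; the half-open sum charges each gap to its
    left end. *)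
Lemma vacant_density z d : vacant z -> vacant (z + d) ->
  d + blocked z <= 2 * k * (\sum_(z <= i < z + d) vacant i) + blocked (z + d).
Proof.
elim/ltn_ind: d z => d IHd z vz vzd.
have [->|d0] := posnP d; first by rewrite addn0 leq_addl.
have ex : exists g, (0 < g) && vacant (z + g) by exists d; rewrite d0.
case: (ex_minnP ex) => g /andP[g0 vzg] gmin.
have gd : g <= d by apply: gmin; rewrite d0.
have gap : g + blocked z <= 2 * k + blocked (z + g).
  apply: gap_bound => // i i0 ig; apply/negP => vi.
  by have := gmin i; rewrite i0 vi => /(_ isT); lia.
have zgd : z + g + (d - g) = z + d by lia.
have := IHd (d - g) _ (z + g) vzg; rewrite zgd => /(_ _ vzd) rest.
rewrite (@big_cat_nat _ _ _ (z + g)) /= ?leq_add2l ?leq_addr //.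
rewrite (big_ltn (m := z) (n := z + g)) ?vz; last by lia.
rewrite !mulnDr muln1.
have := rest ltac:(lia); lia.
Qed.

End Lift.

Lemma sum_periodic (n : nat) (F : nat -> nat) (z : nat) :
  (forall i, F (i + n) = F i) ->
  \sum_(z <= i < z + n) F i = \sum_(0 <= i < n) F i.
Proof.
move=> per; elim: z => [|z IHz] //; rewrite -IHz addSn.
have [->|n0] := posnP n; first by rewrite addn0 !big_geq.
rewrite big_nat_recr /=; last by lia.
by rewrite per addnC -big_ltn //; lia.
Qed.

Lemma independent_card_bound (n k : nat) (S : {set gp_vertex n}) :
  ~~ odd k -> 2 < k -> 0 < n -> independent (@gen_petersen n k) S ->
  2 * k * #|S| <= (2 * k - 1) * n.
Proof.
move=> k_even k_gt2 n0 /forall_inP ind.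
have nadj x y : x \in S -> gp_arc k x y -> y \notin S.
  move=> xS xy; apply/negP => yS.
  by have /forall_inP/(_ y yS) := ind x xS; rewrite /gen_petersen xy.
pose r i : 'I_n := Ordinal (ltn_pmod i n0).
pose u : pred nat := fun i => inl (r i) \in S.
pose v : pred nat := fun i => inr (r i) \in S.
have uu i : u i -> ~~ u i.+1.
  by move=> ui; apply: nadj ui _; rewrite /= modn_mod modnDml addn1.
have uv i : u i -> ~~ v i by move=> ui; apply: nadj ui _; rewrite /=.
have vv i : v i -> ~~ v (i + k).
  by move=> vi; apply: nadj vi _; rewrite /= modn_mod modnDml.
have rD i : r (i + n) = r i by apply: val_inj; rewrite /= modnDr.
have uD i : u (i + n) = u i by rewrite /u rD.
have vD i : v (i + n) = v i by rewrite /v rD.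
have vacD i : vacant u v (i + n) = vacant u v i by rewrite /vacant uD vD.
have [z _ vz] := vacant_near _ _ _ k_even k_gt2 uu uv vv 0.
have vzn : vacant u v (0 + z + n) by rewrite vacD.
have := vacant_density _ _ _ k_even k_gt2 uu uv vv _ _ vz vzn.
(* After one full turn the two [blocked] terms agree and cancel. *)
have -> : blocked k v (0 + z + n) = blocked k v (0 + z).
  by apply: eq_forallb => j; rewrite addnAC vD.
rewrite sum_periodic => [|i]; last by rewrite vacD.
rewrite leq_add2r => dens.
(* Each index contributes exactly one: u_i, v_i, or a vacancy. *)
have cardS : #|S| + \sum_(0 <= i < n) vacant u v i = n.
  rewrite -sum1_card big_mkcond big_sumType /= -big_split big_mkord -big_split.
  rewrite -[RHS]card_ord -sum1_card; apply: eq_bigr => i _.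
  have ri : r i = i by apply: val_inj; rewrite /= modn_small.
  have := uv i; rewrite /vacant /u /v ri.
  by case: (inl i \in S); case: (inr i \in S) => //= /(_ isT).
have : 2 * k * #|S| + 2 * k * \sum_(0 <= i < n) vacant u v i = 2 * k * n.
  by rewrite -mulnDr cardS.
rewrite mulnBl mul1n; lia.
Qed.

Theorem theorem1 (n k : nat) (k_even : ~~ odd k) (k_gt2 : 2 < k)
    (n_gt2k : 2 * k < n) :
  independence_number (@gen_petersen n k) <= ((2 * k - 1) * n) %/ (2 * k).
Proof.
apply/bigmax_leqP => S indS.
rewrite leq_divRL; last by lia.
by rewrite mulnC; apply: independent_card_bound => //; lia.
Qed.
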